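(* Let $d\geq 1$ and let $\{B(x_{i},r_{i})\}_{i=1}^{\infty}$ be a sequence of closed Euclidean balls in $\mathbb{R}^{d}$, with centres $x_i\in\mathbb{R}^d$ and radii $r_i>0$. Assume that $\{B(x_{i},r_{i})\}_{i=1}^{\infty}$ is shrinking locally and that Lebesgue almost every $\alpha\in\mathbb{R}^{d}$ belongs to $\limsup B(x_{i},r_{i})$. Then $$\mathcal{L}^{d}\big(\mathbf{Bad}(\{B(x_{i},r_{i})\}_{i=1}^{\infty})\big)=0.$$
   Context: $\mathcal{L}^{d}$ denotes $d$-dimensional Lebesgue measure, and $B(x,r)$ denotes the closed $d$-dimensional Euclidean ball centred at $x\in\mathbb{R}^{d}$ with radius $r>0$. A countable family of balls $\{B(x_{i},r_{i})\}_{i=1}^{\infty}$ is understood as a family indexed by $i\in\mathbb{N}$ (repetitions allowed, and elements are counted by index). The lim-sup set is $$\limsup B(x_{i},r_{i})=\bigcap_{n=1}^{\infty}\bigcup_{i=n}^{\infty}B(x_{i},r_{i}),$$ i.e. the set of $\alpha\in\mathbb{R}^{d}$ contained in $B(x_i,r_i)$ for infinitely many $i$. The set of badly approximable numbers with respect to $\{B(x_{i},r_{i})\}_{i=1}^{\infty}$ is $$\mathbf{Bad}(\{B(x_{i},r_{i})\}_{i=1}^{\infty})=\{\alpha\in\mathbb{R}^{d}: \text{there exist } \kappa(\alpha)>0 \text{ and } N(\alpha)\in\mathbb{N} \text{ such that } \alpha\notin B(x_{i},\kappa(\alpha)r_{i}) \text{ for all } i\geq N(\alpha)\}.$$ The family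 $\{B(x_{i},r_{i})\}_{i=1}^{\infty}$ is called shrinking locally if for every ball $B(y,r)$ ($y\in\mathbb{R}^d$, $r>0$) and every $\epsilon>0$, there are only finitely many indices $i$ such that $B(x_{i},r_{i})\cap B(y,r)\neq\emptyset$ and $r_{i}>\epsilon$. *)

(* Defs.v *)
From HB Require Import structures.
From mathcomp Require Import all_boot all_order all_algebra.
From mathcomp Require Import all_classical all_reals all_analysis.
From mathcomp Require Import measurable_realfun.
Set Implicit Arguments.
Unset Strict Implicit.
Unset Printing Implicit Defensive.
Import Order.TTheory GRing.Theory Num.Theory.
Import numFieldNormedType.Exports.
Local Open Scope classical_set_scope.
Local Open Scope ring_scope.

(* R^d; its sigma-algebra is the library's product sigma-algebra on tuples,
   i.e., the Borel sigma-algebra. *)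
Notation rn R d := (d.-tuple (measurableTypeR R)).

Section rn_cons.
Context {R : realType} (d : nat).

Definition rn_cons (p : measurableTypeR R * rn R d) : rn R d.+1 :=
  [tuple of p.1 :: p.2].

Definition rn_uncons (x : rn R d.+1) : measurableTypeR R * rn R d :=
  (thead x, [tuple of behead x]).

Lemma rn_unconsK : cancel rn_uncons rn_cons.
Proof. by move=> x; apply/esym; exact: tuple_eta. Qed.

Lemma rn_consK : cancel rn_cons rn_uncons.
Proof.
by move=> [a x]; rewrite /rn_uncons /rn_cons; congr (_, _); exact/val_inj.
Qed.

Lemma measurable_rn_cons : measurable_fun [set: _] rn_cons.
Proof. exact: measurable_cons measurable_fst measurable_snd. Qed.

Lemma measurable_rn_uncons : measurable_fun [set: _] rn_uncons.
Proof.
apply: measurable_fun_pair; first exact: measurable_tnth.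
exact: measurable_behead.
Qed.

End rn_cons.

Section lebesgue_step.
Context {R : realType} (d : nat).
Variable mu : {sigma_finite_measure set (rn R d) -> \bar R}.
Local Open Scope ereal_scope.

Definition lebesgue_step : set (rn R d.+1) -> \bar R :=
  pushforward (lebesgue_measure \x mu) (@rn_cons R d).

Let mcons := @measurable_rn_cons R d.

Let lebesgue_step0 : lebesgue_step set0 = 0.
Proof. exact: measure0. Qed.

Let lebesgue_step_ge0 A : 0 <= lebesgue_step A.
Proof. exact: measure_ge0. Qed.

Let lebesgue_step_sigma_additive : semi_sigma_additive lebesgue_step.
Proof. exact: measure_semi_sigma_additive. Qed.

HB.instance Definition _ := isMeasure.Build _ _ _ lebesgue_step
  lebesgue_step0 lebesgue_step_ge0 lebesgue_step_sigma_additive.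

Lemma lebesgue_step_sigma_finite : sigma_finite setT lebesgue_step.
Proof.
have /sigma_finiteP[F [TF ndF Foo]] := sigma_finiteT (@lebesgue_measure R).
have /sigma_finiteP[G [TG ndG Goo]] := sigma_finiteT mu.
exists (fun n => @rn_uncons R d @^-1` (F n `*` G n)).
  apply/seteqP; split=> // x _.
  have [m _ Fm] : (\bigcup_n F n) (rn_uncons x).1 by rewrite -TF.
  have [n _ Gn] : (\bigcup_n G n) (rn_uncons x).2 by rewrite -TG.
  exists (maxn m n) => //; split.
    by move: Fm; exact/subsetPset/ndF/leq_maxl.
  by move: Gn; exact/subsetPset/ndG/leq_maxr.
move=> n; have [mFn Fn] := Foo n; have [mGn Gn] := Goo n; split.
  rewrite -[X in measurable X]setTI; apply: measurable_rn_uncons => //.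
  exact: measurableX.
rewrite /lebesgue_step /pushforward -comp_preimage.
rewrite (_ : _ \o _ = id); last by apply/funext => p /=; exact: rn_consK.
by rewrite preimage_id product_measure1E// lte_mul_pinfty// ge0_fin_numE.
Qed.

HB.instance Definition _ := Measure_isSigmaFinite.Build _ _ _
  lebesgue_step lebesgue_step_sigma_finite.

End lebesgue_step.

(* L^0 is the unit mass on the one-point space R^0, and L^(d+1) is the product
   measure L^1 \x L^d transported from R * R^d to R^(d+1). *)
Fixpoint lebesgue_rn (R : realType) (d : nat) :
    {sigma_finite_measure set (rn R d) -> \bar R} :=
  match d return {sigma_finite_measure set (rn R d) -> \bar R} with
  | 0 => \d_([tuple] : rn R 0)
  | d'.+1 => lebesgue_step (lebesgue_rn R d')
  end.

Lemma measurable_rn_box (R : realType) (d : nat)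
    (A : 'I_d -> set (measurableTypeR R)) :
  (forall i, measurable (A i)) ->
  measurable [set x : rn R d | forall i, A i (tnth x i)].
Proof.
move=> mA.
rewrite (_ : mkset _ = \big[setI/setT]_(i < d)
    ((fun x : rn R d => tnth x i) @^-1` A i)); last first.
  apply/seteqP; split => [x xA|x].
    by rewrite -bigcap_seq => i _ /=; exact: xA.
  by rewrite -bigcap_seq => xA i; apply: xA => /=; exact: mem_index_enum.
apply: bigsetI_measurable => i _; rewrite -[X in measurable X]setTI.
exact: measurable_tnth.
Qed.

Lemma lebesgue_rn_box (R : realType) (d : nat)
    (A : 'I_d -> set (measurableTypeR R)) :
  (forall i, measurable (A i)) ->
  lebesgue_rn R d [set x | forall i, A i (tnth x i)] =
  (\prod_(i < d) lebesgue_measure (A i))%E.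
Proof.
elim: d A => [|d IHd] A mA.
  by rewrite big_ord0 /= diracE mem_set//; case.
rewrite big_ord_recl -IHd; last by move=> i; exact: mA.
have mB : measurable [set x : rn R d | forall i, A (lift ord0 i) (tnth x i)].
  by apply: (@measurable_rn_box _ _ (fun i => A (lift ord0 i))) => i; exact: mA.
rewrite -(product_measure1E _ _ (mA ord0) mB).
rewrite /= /lebesgue_step /pushforward; congr product_measure1.
apply/seteqP; split => -[a x] /= => [xA|[Aa xA] i].
  split; first exact: (xA ord0).
  move=> i; have := xA (lift ord0 i); rewrite tnthS/=.
  by congr (A _ (tnth _ _)); exact/val_inj.
case: (unliftP ord0 i) => [j|] ->//.
rewrite tnthS; have := xA j; congr (A _ (tnth _ _)); exact/val_inj.
Qed.

Section euclidean_balls.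
Context {R : realType} {d : nat}.
Implicit Types (x y c : rn R d) (r : R).

Definition eucl_dist x y : R :=
  Num.sqrt (\sum_(i < d) (tnth x i - tnth y i : R) ^+ 2).

Definition eucl_ball c r : set (rn R d) := [set x | eucl_dist x c <= r].

Definition Bad (x : nat -> rn R d) (r : nat -> R) : set (rn R d) :=
  [set a | exists2 kappa : R, 0 < kappa &
    exists N : nat, forall i, (N <= i)%N -> ~ eucl_ball (x i) (kappa * r i) a].

Definition shrinking_locally (x : nat -> rn R d) (r : nat -> R) : Prop :=
  forall y (s : R), 0 < s -> forall eps : R, 0 < eps ->
    finite_set [set i | eucl_ball (x i) (r i) `&` eucl_ball y s !=set0 /\
                        eps < r i].

Lemma measurable_eucl_dist (c : rn R d) :
  measurable_fun [set: rn R d] (eucl_dist ^~ c).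
Proof.
have msqrt : measurable_fun [set: R] (@Num.sqrt R).
  by apply: continuous_measurable_fun; exact: sqrt_continuous.
apply: (measurableT_comp msqrt).
apply: measurable_sum => i; apply: measurable_funX.
apply: measurable_funB => //; exact: measurable_tnth.
Qed.

Lemma measurable_eucl_ball (c : rn R d) (r : R) : measurable (eucl_ball c r).
Proof.
rewrite (_ : eucl_ball c r = [set: _] `&` eucl_dist ^~ c @^-1` `]-oo, r]).
  by apply: measurable_eucl_dist.
by rewrite setTI; apply/seteqP; split => x; rewrite /eucl_ball/= in_itv.
Qed.

(* Bad is Borel, so that lebesgue_rn, which is meaningful on Borel sets only,
   applies to it. *)
Lemma measurable_Bad (x : nat -> rn R d) (r : nat -> R) :
  (forall i, 0 < r i) -> measurable (Bad x r).
Proof.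
move=> r0.
rewrite (_ : Bad x r = \bigcup_k \bigcup_N \bigcap_(i >= N)
    ~` eucl_ball (x i) (k.+1%:R^-1 * r i)).
  apply: bigcupT_measurable => k; apply: bigcupT_measurable => N.
  apply: bigcap_measurable; first by exists N => /=.
  by move=> i _; apply: measurableC; exact: measurable_eucl_ball.
apply/seteqP; split => [a [e e0 [N aN]]|a [k _ [N _ aN]]].
  have [k ke] := ltr_add_invr (y := 0) (x := e) e0.
  exists k => //; exists N => // i Ni ai; apply: (aN _ Ni).
  have ke1 : k.+1%:R^-1 <= e by apply: ltW; move: ke; rewrite add0r.
  by apply: (le_trans ai); rewrite ler_pM2r.
by exists k.+1%:R^-1; [rewrite invr_gt0|exists N => i Ni; exact: aN].
Qed.

End euclidean_balls.

(* Main.v *)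
Require Import Defs.
From mathcomp Require Import all_boot all_order all_algebra.
From mathcomp Require Import all_classical all_reals all_analysis.
From mathcomp Require Import measurable_realfun ring lra.
Set Implicit Arguments.
Unset Strict Implicit.
Unset Printing Implicit Defensive.
Import Order.TTheory GRing.Theory Num.Theory.
Import numFieldNormedType.Exports.
Local Open Scope classical_set_scope.
Local Open Scope ring_scope.

(** The bad set is, outside the null complement of the lim-sup set, a countable
    union of bounded pieces [E] on which the constant [kappa <= 1] and the rank
    [N] are fixed: every point of [E] lies in infinitely many balls
    [B(x i, r i)], while [E] misses [B(x i, kappa * r i)] for all [i >= N].
    It suffices to show that such an [E] is null ([missing_balls_null]).

    Fix [e > 0] and an open [U] containing [E] with [U \ E] of measure at most
    [e] ([outer_regular]).  As the radii shrink locally, every point of [E] is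
    in some [B(x i, r i)] with [i >= N] that is so small that the cube
    circumscribed about it lies in [U] ([small_cube_in_open]).  These cubes thus
    cover [E].  In each of them the ball [B(x i, kappa * r i)] occupies a fixed
    proportion of the volume, and this ball lies in [U \ E].  By Vitali's
    covering argument ([vitali_cubes]) the union of the cubes then has measure at
    most [K] times that of the union of the small balls, hence at most [K * e],
    where [K] depends on [kappa] and the dimension only.  So the measure of [E]
    is at most [K * e] for every [e].

    Volumes are only ever computed for cubes, i.e. balls of the sup norm: a
    Euclidean ball is compared with its circumscribed cube and with an inscribed
    one, at the cost of a factor of the dimension, absorbed by [K].

    Outer regularity is derived from the sigma-algebra itself: for a finite
    measure, the sets that can be approximated from outside by open sets, and
    whose complements can be as well, form a sigma-algebra
    ([approximable_sigma_algebra]), which contains the preimages of half-lines by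
    the coordinates, hence all Borel sets. *)

(** * Continuity of measures along monotone sequences *)

Section continuity_of_measure.
Context d (T : measurableType d) (R : realType) (mu : {measure set T -> \bar R}).

Lemma measure_bigcup_le (F : nat -> set T) (c : \bar R) :
  (forall n, measurable (F n)) ->
  {homo F : m n / (m <= n)%N >-> (m <= n)%O} ->
  (forall n, (mu (F n) <= c)%E) -> (mu (\bigcup_n F n) <= c)%E.
Proof.
move=> mF ndF Fc.
have muF := nondecreasing_cvg_mu (mu := mu) mF (bigcupT_measurable _ mF) ndF.
rewrite -(cvg_lim _ muF)//; apply: lime_le.
  by apply/cvg_ex; eexists; exact: muF.
by apply: nearW => n; exact: Fc.
Qed.

Lemma measure_bigcap0_lt (F : nat -> set T) (e : R) :
  (mu (F 0%N) < +oo)%E -> (forall n, measurable (F n)) ->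
  {homo F : m n / (m <= n)%N >-> (n <= m)%O} ->
  \bigcap_n F n = set0 -> 0 < e -> exists n, (mu (F n) < e%:E)%E.
Proof.
move=> F0 mF niF capF e0; apply/not_existsP => Fe.
have muF := nonincreasing_cvg_mu F0 mF (bigcapT_measurable mF) niF.
suff : (e%:E <= mu (\bigcap_n F n))%E.
  by rewrite capF measure0 lee_fin leNgt e0.
rewrite -(cvg_lim _ muF)//; apply: lime_ge.
  by apply/cvg_ex; eexists; exact: muF.
by apply: nearW => n; rewrite leNgt; apply/negP/Fe.
Qed.

End continuity_of_measure.

(** * Approximation by open sets for a finite measure *)

Section approximation.
Context d (T : measurableType d) (R : realType) (mu : {measure set T -> \bar R}).
Variable O : set_system T.
Hypothesis mu_fin : (mu setT < +oo)%E.
Hypothesis Om : O `<=` measurable.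
Hypothesis O0 : O set0.
Hypothesis OT : O setT.
Hypothesis OI : forall U V, O U -> O V -> O (U `&` V).
Hypothesis OU : forall U : nat -> set T, (forall n, O (U n)) -> O (\bigcup_n U n).

(** The set [U `&` V] contains both [U `\` A] and [V `\` ~` A]: asking for it to
    be small approximates [A] and its complement at the same time, which makes
    the notion symmetric. *)
Definition approximable : set_system T := [set A | forall e : R, 0 < e ->
  exists U V, [/\ O U, O V, A `<=` U, ~` A `<=` V & (mu (U `&` V) <= e%:E)%E]].

Lemma approximableC A : approximable A -> approximable (~` A).
Proof.
move=> aA e e0; have [U [V [OU' OV AU AV UV]]] := aA e e0.
by exists V, U; split; rewrite ?setCK// setIC.
Qed.

Let open_bigI (V : nat -> set T) n : (forall i, O (V i)) ->
  O (\bigcap_(i < n) V i).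
Proof.
move=> OV; rewrite bigcap_mkord.
by elim/big_ind : _ => //.
Qed.

(** The delicate side is the complement of the union: an infinite intersection
    of the open sets [V n] need not be open.  A finite intersection is used
    instead, at the cost of the tail [W N] of the union of the [U n], whose
    measure is small for large [N] because [mu] is finite. *)
Lemma approximable_bigcup (A : nat -> set T) :
  (forall n, approximable (A n)) -> approximable (\bigcup_n A n).
Proof.
move=> aA e e0.
have e20 : 0 < e / 2 by rewrite divr_gt0.
(* Half of [e] pays for the [U n `&` V n], the other half for the tail. *)
have en n : 0 < e / 2 / (2 ^ n.+1)%:R by rewrite divr_gt0// ltr0n expn_gt0.
have /choice[U /choice[V UV]] := fun n => aA n _ (en n).
have OUn n : O (U n) by case: (UV n).
have OVn n : O (V n) by case: (UV n).
have mUV n : measurable (U n `&` V n) by apply: measurableI; exact: Om.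
pose W N := (\bigcup_n U n) `\` \bigcup_(n < N) U n.
have mW N : measurable (W N).
  apply: measurableD; first by apply: bigcupT_measurable => n; exact: Om.
  by apply: bigcup_measurable => n _; exact: Om.
have [N WN] : exists N, (mu (W N) < (e / 2)%:E)%E.
  apply: measure_bigcap0_lt => //.
  - by apply: le_lt_trans mu_fin; apply: le_measure; rewrite ?inE.
  - move=> m n mn; apply/subsetPset; apply: setDS.
    apply: bigcup_sub => i /= im; apply: (bigcup_sup (i := i)) => //=.
    exact: leq_trans mn.
  - apply/seteqP; split=> // x Wx.
    have [n _ Unx] : (\bigcup_n U n) x by case: (Wx 0%N).
    by have [_] := Wx n.+1 I; apply; exists n => /=.
exists (\bigcup_n U n), (\bigcap_(n < N) V n); split.
- exact: OU.
- exact: open_bigI.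
- by move=> x [n _ Ax]; exists n => //; case: (UV n) => _ _ AU _ _; exact: AU.
- move=> x nAx n _; case: (UV n) => _ _ _ AV _; apply: AV => Ax.
  by apply: nAx; exists n.
have mB : measurable (\bigcup_n (U n `&` V n)) by exact: bigcupT_measurable.
apply: (@le_trans _ _ (mu (W N `|` \bigcup_n (U n `&` V n)))).
  apply: le_measure; rewrite ?inE.
  - by apply: Om; apply: OI; [exact: OU|exact: open_bigI].
  - exact: measurableU.
  - move=> x [Ux Vx]; have [[n nN Unx]|nUx] := pselect ((\bigcup_(n < N) U n) x).
      by right; exists n => //; split => //; exact: Vx.
    by left; split.
apply: le_trans (measureU2 _ _ _) _ => //.
rewrite [e in leRHS]splitr EFinD; apply: leeD; first exact: ltW.
apply: (@le_trans _ _ (\sum_(0 <= n <oo) mu (U n `&` V n))%E).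
  exact: measure_sigma_subadditive.
have := @epsilon_trick R (fun=> 0%E) (e / 2) xpredT (fun=> lexx _) (ltW e20).
rewrite [in leRHS]eseries0// add0e => sume; apply: le_trans sume.
apply: lee_nneseries => //.
by move=> n _; rewrite add0e; case: (UV n).
Qed.

Lemma approximable_sigma_algebra : sigma_algebra setT approximable.
Proof.
split; last exact: approximable_bigcup; last first.
  by move=> A aA; rewrite setTD; exact: approximableC.
move=> e e0; exists set0, setT; split => //.
by rewrite set0I measure0 lee_fin ltW.
Qed.
End approximation.

(** * Cubes and open sets of R^d *)

Section cubes.
Context {R : realType} {d : nat}.
Implicit Types (x y c : rn R d) (s t : R).

Definition cube c s : set (rn R d) :=
  [set y | forall i, `|tnth y i - tnth c i : R| <= s].

Let side c s (i : 'I_d) : set (measurableTypeR R) :=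
  [set` `[(tnth c i : R) - s, (tnth c i : R) + s]%R].

Let cubeE c s : cube c s = [set y | forall i, side c s i (tnth y i)].
Proof.
apply/seteqP; split=> y /= cy i; have := cy i;
  by rewrite /side/= in_itv/= ler_distl.
Qed.

Lemma measurable_cube c s : measurable (cube c s).
Proof. by rewrite cubeE; apply: measurable_rn_box => i; exact: measurable_itv. Qed.

Lemma lebesgue_rn_cube c s : 0 <= s ->
  lebesgue_rn R d (cube c s) = ((s *+ 2) ^+ d)%:E.
Proof.
move=> s0; rewrite cubeE lebesgue_rn_box; last by move=> i; exact: measurable_itv.
rewrite (eq_bigr (fun=> (s *+ 2)%:E)); last first.
  move=> i _; rewrite /side lebesgue_measure_itv/= lte_fin.
  case: ltP => h; first by rewrite -EFinB; congr EFin; ring.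
  by congr EFin; lra.
by rewrite prodEFin prodr_const card_ord.
Qed.

Lemma cube_triangle x y c s t : cube x s y -> cube y t c -> cube x (s + t) c.
Proof.
move=> xy yc i; apply: le_trans (ler_distD (tnth y i : R) _ _) _.
by rewrite addrC lerD.
Qed.

Lemma cubexx x s : 0 <= s -> cube x s x.
Proof. by move=> s0 i; rewrite subrr normr0. Qed.

Lemma cubeC x y s : cube x s y -> cube y s x.
Proof. by move=> xy i; rewrite distrC. Qed.

Lemma sub_cube x s t : s <= t -> cube x s `<=` cube x t.
Proof. by move=> st y xy i; exact: le_trans (xy i) st. Qed.

Lemma eucl_ball_sub_cube c s : 0 <= s -> eucl_ball c s `<=` cube c s.
Proof.
move=> s0 y; rewrite /eucl_ball/= /eucl_dist => cy i.
rewrite -sqrtr_sqr; apply: le_trans cy; rewrite ler_wsqrtr//.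
by rewrite (bigD1 i)//= lerDl sumr_ge0// => j _; exact: sqr_ge0.
Qed.

(** Dividing by [sqrt d] would suffice; [d] avoids a square root. *)
Lemma cube_sub_eucl_ball c s : (0 < d)%N -> 0 <= s ->
  cube c (s / d%:R) `<=` eucl_ball c s.
Proof.
move=> d0 s0 y cy; rewrite /eucl_ball/= /eucl_dist.
rewrite -[leRHS]ger0_norm// -sqrtr_sqr ler_wsqrtr//.
have sd0 : 0 <= s / d%:R by rewrite divr_ge0.
have d1 : 1 <= d%:R :> R by rewrite ler1n.
apply: (@le_trans _ _ (\sum_(i < d) (s / d%:R) ^+ 2)).
  apply: ler_sum => i _; rewrite -real_normK ?num_real// lerXn2r// nnegrE//.
rewrite sumr_const card_ord.
have -> : (s / d%:R) ^+ 2 *+ d = s ^+ 2 / d%:R by field; lra.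
by rewrite ler_pdivrMr ?ltr0n// ler_peMr ?sqr_ge0.
Qed.

(** Open sets for the sup norm.  Open sets are Borel because R^d is second
    countable; carrying measurability in the definition replaces that argument,
    and the open sets built below are measurable by construction. *)
Definition is_open (U : set (rn R d)) :=
  measurable U /\ forall x, U x -> exists2 s, 0 < s & cube x s `<=` U.

Lemma is_openT : is_open setT. Proof. by split=> // x _; exists 1. Qed.

Lemma is_openI U V : is_open U -> is_open V -> is_open (U `&` V).
Proof.
move=> [mU oU] [mV oV]; split; first exact: measurableI.
move=> x [/oU[s s0 sU] /oV[t t0 tV]]; exists (Num.min s t).
  by rewrite lt_min s0.
by move=> y xy; split; [apply: sU|apply: tV]; apply: sub_cube xy;
  rewrite ge_min lexx ?orbT.
Qed.

Lemma is_open_bigcup (U : nat -> set (rn R d)) :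
  (forall n, is_open (U n)) -> is_open (\bigcup_n U n).
Proof.
move=> oU; split; first by apply: bigcupT_measurable => n; case: (oU n).
move=> x [n _ Unx]; have [_ /(_ _ Unx)[s s0 sU]] := oU n.
by exists s => //; apply: subset_trans sU _; exact: bigcup_sup.
Qed.

Lemma is_open_preimage (i : 'I_d) (B : set R) : open B ->
  is_open ((fun y : rn R d => tnth y i : R) @^-1` B).
Proof.
move=> oB; split.
  rewrite -[X in measurable X]setTI; apply: (measurable_tnth i) => //.
  exact: open_measurable.
move=> x Bx; have /nbhs_ballP[s /= s0 sB] := open_nbhs_nbhs (conj oB Bx).
exists (s / 2); first by rewrite divr_gt0.
move=> y /(_ i) xy; apply: sB; rewrite /ball/= distrC.
by apply: le_lt_trans xy _; rewrite ltr_pdivrMr// ltr_pMr// ltr1n.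
Qed.

End cubes.

(** The Borel sets are generated by the coordinate preimages of open half-lines.
    Such a half-space [a < y_i] is open, and its complement is approximated by
    the open half-spaces [y_i < a + 1 / n.+1], since the slabs
    [a < y_i < a + 1 / n.+1] decrease to the empty set. *)
Lemma finite_measure_approximable (R : realType) d
    (mu : {measure set (rn R d) -> \bar R}) :
  (mu setT < +oo)%E -> measurable `<=` approximable mu is_open.
Proof.
move=> muT.
have sa : sigma_algebra setT (approximable mu is_open).
  apply: approximable_sigma_algebra => //.
  - by move=> U [].
  - exact: is_openT.
  - exact: is_openI.
  - exact: is_open_bigcup.
apply: smallest_sub => // A; rewrite -bigcup_seq => -[i _ [B mB <-]].
rewrite setTI.
pose C : set_system (ocitv_type R) :=
  fun B => approximable mu is_open ((fun y : rn R d => tnth y i) @^-1` B).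
suff CB : (measurable : set_system (measurableTypeR R)) `<=` C by exact: CB.
have sC : sigma_algebra setT C.
  case: sa => [sa0 saC saU]; split=> [|D /saC|F FC]; rewrite /C.
  - by rewrite preimage_set0.
  - by rewrite !setTD preimage_setC.
  - by rewrite preimage_bigcup; exact: saU.
rewrite RGenOInfty.measurableE; apply: smallest_sub; first exact: sC.
move=> D [a ->] e e0.
pose near_a n : set R := `]-oo, a + n.+1%:R^-1[%classic.
have mnear n : measurable
    ((fun y : rn R d => tnth y i : R) @^-1` (`]a, +oo[%classic `&` near_a n)).
  rewrite -[X in measurable X]setTI; apply: (measurable_tnth i) => //.
  by apply: measurableI; exact: measurable_itv.
have : exists n, (mu ((fun y : rn R d => tnth y i : R) @^-1`
    (`]a, +oo[%classic `&` near_a n)) < e%:E)%E.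
  apply: measure_bigcap0_lt => //.
  - by apply: le_lt_trans muT; apply: le_measure; rewrite ?inE.
  - move=> m n mn; apply/subsetPset; apply: preimage_subset; apply: setIS => z.
    rewrite /near_a/= !in_itv/= => /lt_le_trans; apply.
    by rewrite lerD2l lef_pV2 ?posrE ?ltr0n// ler_nat.
  - apply/seteqP; split=> // y ya.
    have := ya 0%N I; rewrite /= !in_itv/= andbT => -[ay _].
    have [n an] := ltr_add_invr ay.
    by have [_] := ya n I; rewrite /near_a/= in_itv/= ltNge (ltW an).
move=> [n mun]; exists ((fun y : rn R d => tnth y i : R) @^-1` `]a, +oo[%classic).
exists ((fun y : rn R d => tnth y i : R) @^-1` near_a n); split => //.
- by apply: is_open_preimage; exact: interval_open.
- by apply: is_open_preimage; exact: interval_open.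
- rewrite preimage_setC; apply: preimage_subset => z.
  rewrite /near_a/= !in_itv/= andbT.
  by move/negP; rewrite -leNgt => /le_lt_trans; apply; rewrite ltrDl.
- by rewrite -preimage_setI ltW.
Qed.

(** * Outer regularity of the Lebesgue measure on bounded sets *)

Section regularity.
Context {R : realType} {d : nat}.
Local Notation lambda := (lebesgue_rn R d).

(** The restriction of the measure to [W] is finite, so [E] has an open
    approximation for it; intersecting that with the open set [W] turns it into
    one for the Lebesgue measure. *)
Lemma outer_regular (E W : set (rn R d)) (e : R) :
  measurable E -> is_open W -> (lambda W < +oo)%E -> E `<=` W -> 0 < e ->
  exists U, [/\ is_open U, E `<=` U & (lambda (U `\` E) <= e%:E)%E].
Proof.
move=> mE oW Wfin EW e0; have mW := oW.1.
have rT : (mrestr lambda mW setT < +oo)%E by rewrite /mrestr setTI.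
have [U [V [oU oV EU EV UV]]] :=
  @finite_measure_approximable R d (mrestr lambda mW) rT E mE e e0.
exists (U `&` W); split; [exact: is_openI|by move=> x Ex; split; auto|].
apply: le_trans UV; rewrite /mrestr; apply: le_measure; rewrite ?inE.
- by apply: measurableD => //; apply: measurableI => //; case: oU.
- by apply: measurableI => //; apply: measurableI; [case: oU|case: oV].
- by move=> x [[Ux Wx] nEx]; split => //; split => //; exact: EV.
Qed.

Definition open_cube (s : R) : set (rn R d) :=
  \big[setI/setT]_(i < d)
    ((fun y : rn R d => tnth y i : R) @^-1` `]- s, s[%classic).

Lemma is_open_cube s : is_open (open_cube s).
Proof.
rewrite /open_cube; elim/big_ind : _ => [|U V|i _].
- exact: is_openT.
- exact: is_openI.
- by apply: is_open_preimage; exact: interval_open.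
Qed.

Lemma in_open_cube s y : open_cube s y <-> forall i, `|tnth y i : R| < s.
Proof.
rewrite /open_cube -bigcap_seq; split=> [ys i|ys i _].
  by have := ys i (mem_index_enum _); rewrite /= in_itv/= ltr_norml.
by have := ys i; rewrite /= in_itv/= ltr_norml.
Qed.

Lemma lebesgue_rn_open_cube_lty s : 0 <= s -> (lambda (open_cube s) < +oo)%E.
Proof.
move=> s0; pose o : rn R d := [tuple of nseq d (0 : measurableTypeR R)].
apply: (@le_lt_trans _ _ (lambda (cube o s))); last first.
  by rewrite lebesgue_rn_cube// ltry.
apply: le_measure; rewrite ?inE.
- exact: (is_open_cube s).1.
- exact: measurable_cube.
- by move=> y /in_open_cube ys i; rewrite tnth_nseq subr0 ltW.
Qed.

Lemma bigcup_open_cube : \bigcup_n open_cube n%:R = setT.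
Proof.
apply/seteqP; split=> // y _.
have [n yn] : exists n, \sum_(i < d) `|tnth y i : R| < n%:R.
  exists (Num.bound (\sum_(i < d) `|tnth y i : R|)).
  by apply: archi_boundP; exact: sumr_ge0.
exists n => //; apply/in_open_cube => i; apply: le_lt_trans yn.
by rewrite (bigD1 i)//= lerDl sumr_ge0.
Qed.

End regularity.

(** * Vitali covering *)

Section vitali.
Context {R : realType} {d : nat}.
Local Notation lambda := (lebesgue_rn R d).
Variables (I : choiceType) (c : I -> rn R d) (r : I -> R) (B : I -> set (rn R d)).
Variable K : R.
Hypotheses (r0 : forall i, 0 <= r i) (mB : forall i, measurable (B i)).
Hypothesis Bcube : forall i, B i `<=` cube (c i) (r i).
Hypothesis K0 : 0 <= K.
Hypothesis BK : forall i, (lambda (cube (c i) (r i *+ 3)) <= K%:E * lambda (B i))%E.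

Let seq_argmax (s : seq I) : s != [::] ->
  exists2 j, j \in s & forall i, i \in s -> r i <= r j.
Proof.
elim: s => // a [_ _|b s IHs _].
  by exists a; rewrite ?mem_head// => i; rewrite inE => /eqP ->.
have [//|j js maxj] := IHs; have [raj|rja] := leP (r a) (r j).
  by exists j => [|i]; rewrite inE ?js ?orbT// => /predU1P[->//|]; exact: maxj.
exists a => [|i]; first exact: mem_head.
by rewrite inE => /predU1P[->//|/maxj/le_trans]; apply; exact: ltW.
Qed.

(** Keep a cube of largest radius, [cube (c j) (r j)], and discard those that
    meet it: they are contained in the cube with the same centre and a radius three
    times larger, whose measure is controlled by that of [B j].  The remaining
    cubes are disjoint from [cube (c j) (r j)], so their sets [B i] are disjoint
    from [B j] and the estimates for [B j] and for the rest add up. *)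
Lemma vitali_cubes (s : seq I) :
  (lambda (\bigcup_(i in [set` s]) cube (c i) (r i)) <=
   K%:E * lambda (\bigcup_(i in [set` s]) B i))%E.
Proof.
have mCs (t : seq I) : measurable (\bigcup_(i in [set` t]) cube (c i) (r i)).
  by rewrite bigcup_seq; apply: bigsetU_measurable => i _; exact: measurable_cube.
have mBs (t : seq I) : measurable (\bigcup_(i in [set` t]) B i).
  by rewrite bigcup_seq; exact: bigsetU_measurable.
have [n sn] := ubnP (size s); elim: n => // n IHn in s sn *.
have [->|s_neq0] := eqVneq s [::].
  by rewrite set_nil !bigcup_set0 !measure0 mule0.
have [j js maxj] := seq_argmax s_neq0.
pose far i := `[< cube (c i) (r i) `&` cube (c j) (r j) = set0 >].
pose t := [seq i <- s | far i].
have tn : (size t < n)%N.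
  rewrite -ltnS; apply: leq_trans sn; rewrite ltnS size_filter ltn_neqAle.
  rewrite count_size andbT -all_count; apply/allPn; exists j => //.
  by apply/asboolP/eqP/set0P; exists (c j); split; exact: cubexx.
have jt : B j `&` \bigcup_(i in [set` t]) B i = set0.
  apply/seteqP; split=> // y [Bjy [i /=]].
  rewrite mem_filter => /andP[/asboolP far_i _] Biy.
  by suff : set0 y by []; rewrite -far_i; split; exact: Bcube.
apply: (@le_trans _ _ (lambda (cube (c j) (r j *+ 3) `|`
    \bigcup_(i in [set` t]) cube (c i) (r i)))).
  apply: le_measure; rewrite ?inE//.
    by apply: measurableU => //; exact: measurable_cube.
  move=> y [i /= si yi]; have [far_i|] := boolP (far i).
    by right; exists i => //=; rewrite mem_filter far_i.
  move=> /asboolP/eqP/set0P[z [zi zj]]; left.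
  have := cube_triangle (cube_triangle zj (cubeC zi)) yi.
  by apply: sub_cube; have := maxj _ si; lra.
apply: le_trans (measureU2 _ _ _) _ => //; first exact: measurable_cube.
apply: (@le_trans _ _
    (K%:E * lambda (B j) + K%:E * lambda (\bigcup_(i in [set` t]) B i))%E).
  by apply: leeD; [exact: BK|apply: IHn].
rewrite -ge0_muleDr ?measure_ge0// -measureU//.
apply: lee_pmul => //; apply: le_measure; rewrite ?inE//; first exact: measurableU.
move=> y [Bjy|[i /=]]; first by exists j.
by rewrite mem_filter => /andP[_ si] Biy; exists i.
Qed.

End vitali.

(** * The pieces of the bad set *)

Section bad_null.
Context {R : realType} {d : nat}.
Local Notation lambda := (lebesgue_rn R d).
Variables (x : nat -> rn R d) (r : nat -> R).
Hypothesis d0 : (0 < d)%N.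
Hypothesis r0 : forall i, 0 < r i.
Hypothesis shrink : shrinking_locally x r.
Let limsup := lim_sup_set (fun i => eucl_ball (x i) (r i)).

(** If [cube a s] lies in [U], only finitely many balls that contain [a] have a
    radius above [s / 2]; for any other ball containing [a], the triangle
    inequality puts the circumscribed cube inside [cube a s]. *)
Lemma small_cube_in_open (U : set (rn R d)) (a : rn R d) (N : nat) :
  is_open U -> U a -> limsup a ->
  exists i, [/\ (N <= i)%N, cube (x i) (r i) `<=` U & cube (x i) (r i) a].
Proof.
move=> [_ oU] /oU[s s0 sU] lima.
have s20 : 0 < s / 2 by rewrite divr_gt0.
have /finite_seqP[big bigE] := shrink a ltr01 s20.
have [i /= Mi ai] := lima (maxn N (\max_(i <- big) i).+1) I.
have aa : eucl_ball a 1 a.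
  rewrite /eucl_ball/= /eucl_dist big1 ?sqrtr0// => j _.
  by rewrite subrr expr0n.
have small_i : r i <= s / 2.
  rewrite leNgt; apply/negP => large_i.
  have : i \in big.
    by have : [set` big] i by rewrite -bigE; split => //; exists a.
  move=> i_big; have : (i <= \max_(j <- big) j)%N by exact: leq_bigmax_seq.
  by move: Mi; rewrite geq_max => /andP[_ /leq_trans]/[apply]; rewrite ltnn.
have cube_a : cube (x i) (r i) a by apply: eucl_ball_sub_cube => //; exact: ltW.
exists i; split => //; first by move: Mi; rewrite geq_max => /andP[].
apply: subset_trans sU => y xy; have := cube_triangle (cubeC cube_a) xy.
by apply: sub_cube; lra.
Qed.

(** The sets [B i] of the covering argument are cubes inscribed in the balls
    [eucl_ball (x i) (kappa * r i)] that [E] avoids, so their union is part of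
    [U `\` E]; the condition [kappa <= 1] keeps them inside the cubes that cover
    [E]. *)
Lemma missing_balls_null (E W : set (rn R d)) (kappa : R) (N : nat) :
  0 < kappa -> kappa <= 1 -> measurable E -> is_open W -> (lambda W < +oo)%E ->
  E `<=` W -> E `<=` limsup ->
  (forall i, (N <= i)%N -> E `&` eucl_ball (x i) (kappa * r i) = set0) ->
  lambda E = 0%E.
Proof.
move=> kappa0 kappa1 mE oW Wfin EW Elim Emiss.
(* The ratio of the volumes of the cubes of radii [3 * r i] and
   [kappa * r i / d]. *)
pose K : R := (3 * d%:R / kappa) ^+ d.
have dR0 : 0 < d%:R :> R by rewrite ltr0n.
have d1 : 1 <= d%:R :> R by rewrite ler1n.
have K0 : 0 < K by rewrite exprn_gt0// divr_gt0// mulr_gt0.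
pose B i := cube (x i) (kappa * r i / d%:R).
have kr0 i : 0 <= kappa * r i by rewrite mulr_ge0// ltW.
have Bcube i : B i `<=` cube (x i) (r i).
  apply: sub_cube; rewrite ler_pdivrMr//.
  apply: (@le_trans _ _ (r i)); first by rewrite ler_piMl ?(ltW (r0 i)).
  by rewrite ler_peMr ?(ltW (r0 i)).
have BK i : (lambda (cube (x i) (r i *+ 3)) <= K%:E * lambda (B i))%E.
  rewrite !lebesgue_rn_cube ?divr_ge0// ?mulrn_wge0 ?(ltW (r0 i))//.
  rewrite -EFinM lee_fin -exprMn.
  have -> : r i *+ 3 *+ 2 = 3 * d%:R / kappa * (kappa * r i / d%:R *+ 2).
    by field; rewrite !gt_eqF.
  by [].
apply/eqP; rewrite eq_le measure_ge0 andbT; apply/lee_addgt0Pr => e e0.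
rewrite add0e.
have eK0 : 0 < e / K by rewrite divr_gt0.
have [U [oU EU UE]] := outer_regular mE oW Wfin EW eK0.
pose inU i := (N <= i)%N && `[< cube (x i) (r i) `<=` U >].
pose s n := [seq i <- iota 0 n | inU i].
pose G n := \bigcup_(i in [set` s n]) cube (x i) (r i).
have mG n : measurable (G n).
  by rewrite /G bigcup_seq; apply: bigsetU_measurable => i _; exact: measurable_cube.
apply: (@le_trans _ _ (lambda (\bigcup_n G n))).
  apply: le_measure; rewrite ?inE//; first exact: bigcupT_measurable.
  move=> a Ea; have [i [Ni iU ai]] := small_cube_in_open N oU (EU _ Ea) (Elim _ Ea).
  exists i.+1 => //; exists i => //=.
  by rewrite mem_filter mem_iota/= add0n ltnSn andbT /inU Ni; exact/asboolP.
apply: measure_bigcup_le => // [m n mn|n].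
  apply/subsetPset; apply: bigcup_subset => i /=.
  rewrite !mem_filter !mem_iota/= !add0n => /andP[-> im].
  exact: leq_trans mn.
apply: le_trans (vitali_cubes _ _ Bcube (ltW K0) BK (s n)) _.
- by move=> i; exact: ltW.
- by move=> i; exact: measurable_cube.
apply: (@le_trans _ _ (K%:E * lambda (U `\` E))%E).
  apply: lee_pmul => //; first by rewrite lee_fin ltW.
  have mB : measurable (\bigcup_(i in [set` s n]) B i).
    by rewrite bigcup_seq; apply: bigsetU_measurable => i _; exact: measurable_cube.
  apply: le_measure; rewrite ?inE//; first by apply: measurableD => //; case: oU.
  apply: bigcup_sub => i /=; rewrite mem_filter => /andP[/andP[Ni /asboolP iU] _] y By.
  split; first exact/iU/Bcube.
  move=> Ey; suff : set0 y by []; rewrite -(Emiss i Ni); split => //.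
  exact: cube_sub_eucl_ball.
apply: (@le_trans _ _ (K%:E * (e / K)%:E)%E).
  by apply: lee_pmul => //; rewrite lee_fin ltW.
by rewrite -EFinM lee_fin mulrC divfK// gt_eqF.
Qed.

End bad_null.

Theorem theorem1p1 (R : realType) (d : nat) (hd : (1 <= d)%N)
    (x : nat -> rn R d) (r : nat -> R) (hr : forall i, 0 < r i)
    (hshrink : shrinking_locally x r)
    (hlimsup : {ae lebesgue_rn R d,
      forall a, lim_sup_set (fun i => eucl_ball (x i) (r i)) a}) :
  lebesgue_rn R d (Bad x r) = 0%E.
Proof.
apply: measure_negligible; first exact: measurable_Bad.
pose limsup := lim_sup_set (fun i => eucl_ball (x i) (r i)).
have mlimsup : measurable limsup.
  apply: bigcapT_measurable => n; apply: bigcup_measurable => i _.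
  exact: measurable_eucl_ball.
pose piece k N M := limsup `&` open_cube M%:R `&`
  \bigcap_(i in [set i | N <= i]%N) ~` eucl_ball (x i) (k.+1%:R^-1 * r i).
have piece0 k N M : (lebesgue_rn R d).-negligible (piece k N M).
  have mpiece : measurable (piece k N M).
    apply: measurableI; first by apply: measurableI => //; exact: (is_open_cube _).1.
    apply: bigcap_measurable => [|i _]; first by exists N => /=.
    by apply: measurableC; exact: measurable_eucl_ball.
  apply/negligibleP => //.
  apply: (missing_balls_null hd hr hshrink (kappa := k.+1%:R^-1) (N := N) _ _ mpiece
    (is_open_cube M%:R)).
  - by rewrite invr_gt0.
  - by rewrite invf_le1// ler1n.
  - exact: lebesgue_rn_open_cube_lty.
  - by move=> a [[]].
  - by move=> a [[]].
  - by move=> i Ni; apply/seteqP; split=> // a [[_ /(_ i Ni)]].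
apply: (@negligibleS _ _ _ _
    (~` limsup `|` \bigcup_k \bigcup_N \bigcup_M piece k N M)); last first.
  apply: negligibleU; first exact: hlimsup.
  by do 3 (apply: negligible_bigcup => ?).
move=> a [e e0 [N aN]].
have [lima|nlima] := pselect (limsup a); last by left.
have [k ke] := ltr_add_invr (y := 0) (x := e) e0.
have [M _ aM] : (\bigcup_n open_cube n%:R) a by rewrite bigcup_open_cube.
right; exists k => //; exists N => //; exists M => //; split => // i Ni ai.
apply: (aN _ Ni); apply: le_trans ai _; rewrite ler_wpM2r// ltW//.
by rewrite add0r in ke.
Qed.
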